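(* Let $k$ be a positive integer and let $S = \{s_1, s_2, \dots\} \subseteq \mathbb{Z}^+$ be an infinite set with elements listed in increasing order $s_1 < s_2 < \cdots$, such that $\liminf_{i \to \infty} (s_{i+k} - s_i) = \infty$. Then $\mathrm{ord}(S) \le k+1$.
   Context: $\mathbb{Z}^+$ denotes the set of positive integers. A walk over a set $S \subseteq \mathbb{Z}^+$ is a finite or infinite sequence of integers $a_1, a_2, \dots$ such that $a_{i+1} - a_i \in S$ for all $i$ (for which $a_{i+1}$ is defined). For a positive integer $m$, the set $S$ is $m$-walkable if every coloring of $\mathbb{Z}$ with $m$ colors admits an infinitely long monochromatic walk over $S$. The order of $S$ is $\mathrm{ord}(S) := \sup\{m : S \text{ is } m\text{-walkable}\}$. *)

(* Defs.v *)
From mathcomp Require Import all_boot all_order all_algebra.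
From mathcomp Require Import all_classical all_reals all_analysis.
Set Implicit Arguments.
Unset Strict Implicit.
Unset Printing Implicit Defensive.

Import Order.TTheory GRing.Theory Num.Theory.
Local Open Scope classical_set_scope.
Local Open Scope ring_scope.

Definition positive_integers : set int := [set n | 0 < n].

Definition infinite_walk (S : set int) (a : nat -> int) : Prop :=
  forall i, S (a i.+1 - a i).

Definition monochromatic (m : nat) (c : int -> 'I_m) (a : nat -> int) : Prop :=
  forall i j, c (a i) = c (a j).

Definition walkable (m : nat) (S : set int) : Prop :=
  forall c : int -> 'I_m, exists a, infinite_walk S a /\ monochromatic c a.

(* The order may be infinite, so it is valued in the extended reals.  Every
   nonempty S is 1-walkable, so the supremum of the empty set (-oo) only
   arises for S empty. *)
Definition ord (R : realType) (S : set int) : \bar R :=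
  ereal_sup [set m%:R%:E | m in [set m : nat | (0 < m)%N /\ walkable m S]].

(* Main.v *)
Require Import Defs.
From mathcomp Require Import all_boot all_order all_algebra zify.
From mathcomp Require Import all_classical all_reals all_analysis.
Import Order.TTheory GRing.Theory Num.Theory.
Local Open Scope classical_set_scope.
Local Open Scope ring_scope.

(** Why the order is at most [k + 1].  Let [m >= k + 2]; here is a colouring
    of the integers with [m] colours and no infinite monochromatic walk.

    Cut the nonnegative integers into consecutive blocks, block [j] being
    [b j <= y < b j.+1], that grow so fast that, for a point [y] of block
    [j + 1], at most [k] elements [z] of [S] satisfy [y - b j < z <= y]
    (lemmas [sparse_blocks] and [window_indices]).  In other words, at most [k]
    of the points lying two blocks or more before [y] can reach [y] by one step
    of a walk.  Colour the points in increasing order, so that [y] differs from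
    each of these at most [k] points and so that no point of block [j] receives
    the colour [j %% m]; this forbids at most [k + 1] colours at each point,
    hence the greedy procedure never stops ([greedy_coloring]).  A negative
    integer gets the colour of its absolute value: walks increase, hence leave
    the negative integers for good ([natural_walk]).

    By construction a step that jumps over a whole block changes the colour,
    so a monochromatic walk must visit every block beyond the one where it
    enters the nonnegative integers ([no_skipped_value]).  One of these blocks
    has an index congruent mod [m] to the colour of the walk, and no point of
    that block has this colour. *)

Lemma fresh_color (T : finType) (s : seq T) :
  (size s < #|T|)%N -> exists t, t \notin s.
Proof.
move=> lt_s; apply: contrapT => no_t.
suff : (#|T| <= size s)%N by rewrite leqNgt lt_s.
apply: leq_trans (card_size s); apply/subset_leq_card/fintype.subsetP => t _.
by apply: contrapT => /negP t_s; apply: no_t; exists t.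
Qed.

(** When [y] is reached, the fixed list [E y] and the colours of the earlier
    points of [F y] exclude fewer than [#|T|] colours, so one is left. *)
Lemma greedy_coloring (T : finType) (E : nat -> seq T) (F : nat -> seq nat) :
  (forall y, size (E y) + size (F y) < #|T|)%N ->
  exists c : nat -> T, forall y,
    c y \notin E y /\ forall x, x \in F y -> (x < y)%N -> c y != c x.
Proof.
move=> small.
have /choice[next nextP] : forall p : (nat -> T) * nat,
    exists t, t \notin E p.2 ++ map p.1 (F p.2).
  by move=> p; apply: fresh_color; rewrite size_cat size_map.
have [t0 _] := fresh_color _ _ (leq_ltn_trans (leq_addr _ _) (small 0%N)).
(* [C n] colours the points below [n] correctly; its other values are junk. *)
pose fix C n : nat -> T :=
  if n is y.+1 then fun x => if x == y then next (C y, y) else C y x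
  else fun=> t0.
have stable x n : (x < n)%N -> C n x = C x.+1 x.
  elim: n => //= n IHn; rewrite ltnS leq_eqVlt eqxx => /predU1P[->|lt_xn].
    by rewrite eqxx.
  by rewrite (ltn_eqF lt_xn) IHn //= eqxx.
exists (fun x => C x.+1 x) => y.
have := nextP (C y, y); rewrite mem_cat negb_or => /andP[notE notF].
rewrite [C y.+1 y]/= eqxx; split=> // x Fx lt_xy.
by apply: contraNneq notF => ->; rewrite -(stable _ _ lt_xy) map_f.
Qed.

(** The indices start at the first [i0] with [x < s i0], and the gap at [i0]
    pushes [s (i0 + k)] beyond the window. *)
Lemma window_indices (s : nat -> int) (k : nat) (x L : int) :
  (forall i j, (i <= j)%N -> s i <= s j) ->
  (forall i, x < s i -> L <= s (i + k)%N - s i) ->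
  exists i0, forall i, x < s i -> s i <= x + L -> i \in iota i0 k.
Proof.
move=> s_le gap.
have [ex_i|no_i] := pselect (exists i, x < s i); last first.
  by exists 0%N => i lt_xs; case: no_i; exists i.
case: (ex_minnP ex_i) => i0 lt_xi0 min_i0; exists i0 => i lt_xi le_i.
rewrite mem_iota (min_i0 _ lt_xi) ltnNge; apply/negP => /s_le le_i0k.
have := gap _ lt_xi0; lia.
Qed.

(** A step that leaves from below [b j] and lands at [b j.+1] or beyond is
    longer than [b j.+1 - b j]; choosing [b j.+1] large after [b j] makes all
    such steps lie where the [k]-step gaps of [s] are at least [b j], the
    number of possible departure points. *)
Lemma sparse_blocks (s : nat -> int) (k : nat) :
  (forall i j, (i <= j)%N -> s i <= s j) ->
  (forall L : int, exists n, forall i, (n <= i)%N -> L <= s (i + k)%N - s i) ->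
  exists b : nat -> nat, [/\ b 0%N = 0%N, forall j, (b j < b j.+1)%N &
    forall j i, (b j.+1)%:Z < s i + (b j)%:Z ->
      (b j)%:Z <= s (i + k)%N - s i].
Proof.
move=> s_le gap.
pose far (p q : nat) := (p < q)%N /\ forall i, q%:Z < s i + p%:Z ->
  p%:Z <= s (i + k)%N - s i.
have next p : {q | far p q}.
  apply: cid; have [n gap_n] := gap p%:Z; exists (p + `|s n|).+1%N.
  split=> [|i lt_i]; first lia.
  by apply: gap_n; rewrite leqNgt; apply/negP => /ltnW/s_le; lia.
have [b [b0 bS]] := dependent_choice next 0%N.
by exists b; split=> // j; have [] := bS j.
Qed.

Lemma block_index (b : nat -> nat) :
  b 0%N = 0%N -> (forall j, (b j < b j.+1)%N) ->
  exists beta : nat -> nat, forall y, (b (beta y) <= y < b (beta y).+1)%N.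
Proof.
move=> b0 bS.
suff /choice[beta betaP] : forall y, exists j, (b j <= y < b j.+1)%N.
  by exists beta.
move=> y.
have le_b j : (j <= b j)%N by elim: j => // j IHj; apply: leq_ltn_trans (bS j).
have ex_j : exists j, (b j <= y)%N by exists 0%N; rewrite b0.
have ub j : (b j <= y)%N -> (j <= y)%N by apply: leq_trans.
case: (ex_maxnP ex_j ub) => j le_j max_j; exists j; rewrite le_j /= ltnNge.
by apply/negP => /max_j; rewrite ltnn.
Qed.

Lemma no_skipped_value (f : nat -> nat) (j : nat) :
  (forall i, f i.+1 <= (f i).+1)%N -> (f 0%N <= j)%N ->
  (exists i, j <= f i)%N -> exists i, f i = j.
Proof.
move=> f_step le_f0 ex_i; case: (ex_minnP ex_i) => -[|i] le_j min_i.
  by exists 0%N; apply/eqP; rewrite eqn_leq le_f0.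
exists i.+1; apply/eqP; rewrite eqn_leq le_j andbT.
apply: leq_trans (f_step i) _; rewrite ltnNge; apply/negP => /min_i.
by rewrite ltnn.
Qed.

(** Steps are at least 1, so [`|a 0|] of them bring a walk [a] into the
    nonnegative integers, where it stays. *)
Lemma natural_walk (m : nat) (S : set int) (c : nat -> 'I_m) :
  S `<=` positive_integers -> walkable m S ->
  exists (w : nat -> nat) (t : 'I_m), forall i,
    [/\ (w i < w i.+1)%N, S ((w i.+1)%:Z - (w i)%:Z) & c (w i) = t].
Proof.
move=> Spos /(_ (fun z => c `|z|%N))[a [a_walk a_mono]].
have a_step i : a i < a i.+1.
  by have /Spos := a_walk i; rewrite /positive_integers /=; lia.
have a_ge i : a 0%N + i%:Z <= a i.
  by elim: i => [|i IHi]; [lia|have := a_step i; lia].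
pose w i := `|a (`|a 0| + i)|%N.
have wE i : (w i)%:Z = a (`|a 0| + i)%N.
  by have := a_ge (`|a 0%N| + i)%N; rewrite /w; lia.
exists w, (c (w 0%N)) => i; split.
- by have := a_step (`|a 0%N| + i)%N; rewrite -addnS -!wE; lia.
- by rewrite !wE addnS; apply: a_walk.
- exact: a_mono.
Qed.

Lemma not_walkable (k m : nat) (S : set int) (s : nat -> int) :
  S `<=` positive_integers -> range s = S ->
  (forall i j, (i <= j)%N -> s i <= s j) ->
  (forall L : int, exists n, forall i, (n <= i)%N -> L <= s (i + k)%N - s i) ->
  (k.+1 < m)%N -> ~ walkable m S.
Proof.
move=> Spos sS s_le gap lt_km Sm.
have m_gt0 : (0 < m)%N by exact: leq_trans lt_km.
have [b [b0 bS b_gap]] := sparse_blocks _ _ s_le gap.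
have b_le : {homo b : i j / (i <= j)%N}.
  by apply: homo_leq => // [|j]; [exact: leq_trans|exact: ltnW].
have [beta betaP] := block_index _ b0 bS.
(* The points below [b (beta y).-1] are those at least two blocks before [y];
   if [y] is in block 0 there is none, as [b 0 = 0]. *)
have /choice[i0 i0P] : forall y : nat, exists i0, forall i,
    y%:Z - (b (beta y).-1)%:Z < s i -> s i <= y%:Z -> i \in iota i0 k.
  move=> y; have [|i0 i0P] := window_indices s k (y%:Z - (b (beta y).-1)%:Z)
      (b (beta y).-1)%:Z s_le; last first.
    by exists i0 => i lt_i le_i; apply: i0P => //; lia.
  move=> i; have /andP[] := betaP y; case: (beta y) => [|j] /= le_y _ lt_i.
    by rewrite b0; have := s_le i (i + k)%N (leq_addr _ _); lia.
  by apply: b_gap; lia.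
(* [E y] keeps the colour [j %% m] out of block [j]; [F y] contains every point
   two blocks or more before [y] from which one step leads to [y]. *)
pose E y := [:: Ordinal (ltn_pmod (beta y) m_gt0)].
pose F y := [seq `|y%:Z - s i|%N | i <- iota (i0 y) k].
have [|c cP] := greedy_coloring _ E F.
  by move=> y; rewrite size_map size_iota card_ord.
have [w [t wP]] := natural_walk _ _ c Spos Sm.
have w_ge i : (i <= w i)%N.
  by elim: i => // i IHi; have [lt_w _ _] := wP i; apply: leq_ltn_trans lt_w.
(* A step over a whole block would start in [F (w i.+1)] and change colour. *)
have beta_step i : (beta (w i.+1) <= (beta (w i)).+1)%N.
  rewrite leqNgt; apply/negP => jump; have [lt_w Sw c_i] := wP i.
  have [_ _ c_i1] := wP i.+1; have [_ /(_ (w i))] := cP (w i.+1).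
  rewrite c_i c_i1 eqxx => F_w.
  suff /F_w/(_ lt_w) : w i \in F (w i.+1) by [].
  move: Sw; rewrite -sS => -[l _ sl]; apply/mapP.
  exists l; last by rewrite sl; lia.
  have /andP[_ lt_wi] := betaP (w i).
  have le_b : (b (beta (w i)).+1 <= b (beta (w i.+1)).-1)%N by apply: b_le; lia.
  by apply: i0P; rewrite sl; lia.
(* A block whose missing colour is [t], not before the block of [w 0]. *)
pose j := (t + m * beta (w 0%N))%N.
have [||i beta_i] := no_skipped_value (fun i => beta (w i)) j beta_step.
- by rewrite /j; have := leq_pmull (beta (w 0%N)) m_gt0; lia.
- exists (b j); rewrite leqNgt; apply/negP => /b_le.
  by have /andP[_ ] := betaP (w (b j)); have := w_ge (b j); lia.
have [_ _ c_i] := wP i; have [] := cP (w i).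
rewrite c_i inE -val_eqE /= beta_i /j mulnC addnC modnMDl.
by rewrite modn_small // eqxx.
Qed.

Lemma limn_einf_pinfty_int (R : realType) (g : nat -> int) :
  limn_einf (fun i => ((g i)%:~R : R)%:E) = +oo%E ->
  forall L : int, exists n, forall i, (n <= i)%N -> L <= g i.
Proof.
set u := (fun i => _); rewrite limn_einf_lim => lim_u L.
have [n lt_L] : exists n, ((L%:~R : R)%:E < einfs u n)%E.
  apply: contrapT => no_n; suff : (+oo <= (L%:~R : R)%:E)%E by [].
  rewrite -lim_u; apply: lime_le; first exact: is_cvg_einfs.
  by apply: nearW => n; rewrite leNgt; apply/negP => ?; apply: no_n; exists n.
exists n => i le_ni; have : ((L%:~R : R)%:E < u i)%E.
  by apply: lt_le_trans lt_L _; apply: ereal_inf_lbound; exists i.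
by rewrite lte_fin ltr_int => /ltW.
Qed.

Theorem theorem3p2 (R : realType) (k : nat) (hk : (0 < k)%N)
    (S : set int) (hpos : S `<=` positive_integers) (hinf : infinite_set S)
    (s : nat -> int) (hincr : forall i j : nat, (i < j)%N -> s i < s j)
    (henum : range s = S)
    (hliminf : limn_einf (fun i : nat => ((s (i + k)%N - s i)%:~R : R)%:E)
               = +oo%E) :
  (ord R S <= (k + 1)%:R%:E)%E.
Proof.
have s_le i j : (i <= j)%N -> s i <= s j.
  by rewrite leq_eqVlt => /predU1P[->//|/hincr/ltW].
have gap := limn_einf_pinfty_int _ _ hliminf.
apply: ge_ereal_sup => _ [m [_ Sm] <-]; rewrite lee_fin ler_nat addn1 leqNgt.
by apply/negP => lt_km; apply: not_walkable hpos henum s_le gap lt_km Sm.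
Qed.
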